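(* Let $Y\subseteq\{0,1\}^{\mathbb Z}$ be a minimal subshift. Then $X=\eta_{2,2}^{-1}(Y)$ is minimal if and only if there exist sequences of words $w^{(n)},v^{(n)}\in\mathcal W(Y)$, $n\in\mathbb N$, such that $|w^{(n)}|\to\infty$ as $n\to\infty$, and for all $n\in\mathbb N$ we have $w^{(n)}v^{(n)}w^{(n)}\in\mathcal W(Y)$ and $$\sum_{j=0}^{|w^{(n)}v^{(n)}|-1}\left(w^{(n)}v^{(n)}\right)_j$$ is odd.
   Context: $\{0,1\}^{\mathbb Z}$ carries the product topology; $\sigma$ is the left shift, $\sigma(x)_n=x_{n+1}$. A subshift is a closed $\sigma$-invariant subset; it is minimal if it is nonempty and all its $\sigma$-orbits are dense. $\mathcal W(Y)$ is the set of all finite words (including the empty word) occurring in sequences of $Y$; $|w|$ is the length of $w=w_0\ldots w_{|w|-1}$ and $wv$ denotes concatenation. $\eta_{2,2}:\{0,1\}^{\mathbb Z}\to\{0,1\}^{\mathbb Z}$ is given by $\eta_{2,2}(x)_n=x_{n+1}-x_n\bmod 2$. *)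

(* Defs.v *)
From mathcomp Require Import all_boot all_order all_algebra.
From mathcomp Require Import all_classical all_reals all_analysis.

Set Implicit Arguments.
Unset Strict Implicit.
Unset Printing Implicit Defensive.

Import GRing.Theory.

Local Open Scope classical_set_scope.
Local Open Scope ring_scope.

(* The full shift {0,1}^Z; {ptws _ -> _} carries the product topology, bool
   being discrete. *)
Notation full_shift := {ptws int -> bool}.

Definition shift (x : full_shift) : full_shift := fun n => x (n + 1).

Definition shiftz (k : int) (x : full_shift) : full_shift := fun n => x (n + k).

(* shiftz k is the k-th power of the shift, for k of either sign. *)
Lemma iter_shift (k : nat) (x : full_shift) : iter k shift x = shiftz k%:Z x.
Proof.
elim: k => [|k IHk]; apply/funext => n; first by rewrite /shiftz addr0.
by rewrite iterS IHk /shift /shiftz -addrA -PoszD.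
Qed.

Lemma shiftzNK (k : int) (x : full_shift) : shiftz k (shiftz (- k) x) = x.
Proof. by apply/funext => n; rewrite /shiftz addrK. Qed.

Definition shift_orbit (x : full_shift) : set full_shift :=
  range (fun k : int => shiftz k x).

(* Shifts are two-sided, so invariance means shift(Y) = Y. *)
Definition subshift (Y : set full_shift) : Prop :=
  closed Y /\ shift @` Y = Y.

Definition minimal_subshift (Y : set full_shift) : Prop :=
  [/\ subshift Y, Y !=set0 & forall x, Y x -> Y `<=` closure (shift_orbit x)].

Definition language (Y : set full_shift) : set (seq bool) :=
  [set w | exists2 x, Y x &
     exists (i : int) (l : nat), w = mkseq (fun j => x (i + j%:Z)) l].

(* The subtraction is that of the field structure of bool, i.e. modulo 2. *)
Definition eta22 (x : full_shift) : full_shift := fun n => x (n + 1) - x n.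

(* Main.v *)
Require Import Defs.
From mathcomp Require Import all_boot all_order all_algebra.
From mathcomp Require Import all_classical all_reals all_analysis.
From mathcomp Require Import zify.

(** Write X for the preimage of Y.  A sequence x is recovered from eta22 x up to
complementation: the sum of eta22 x over [a, a + q[ is x (a + q) - x a modulo 2
(parity_eta22).  Hence, if eta22 x carries the same word of length n at a and
at a + q, with an odd sum over [a, a + q[, then the word of length n + 1 of x
at a + q is the complement of the one at a, and conversely (flipP).  So a word
w v w of Y with w v of odd sum is the same thing as a word of X seen twice, the
second time complemented, at non-overlapping places (up to one letter).

If X is minimal, then it contains the complement of each of its points x, so
long words of the complement occur in x itself; this gives the flips, provided
the two occurrences can be taken far apart.  If they are not, at a distance k
say, then a long stretch of x changes sign under translation by k, hence also
under translation by any odd multiple of k (flip_odd_multiple).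

Conversely, let x, z be points of X and consider a word of z.  By compactness,
the corresponding word of eta22 z has bounded gaps in Y (bounded_gaps), so it
occurs within every long enough w, and therefore at two corresponding places of
an occurrence of w v w in eta22 x.  Above the first place, x reads the word of
z or its complement; above the second place it reads the other of the two. *)

Import GRing.Theory.
Local Open Scope classical_set_scope.
Local Open Scope ring_scope.

(** * Words of a sequence *)

Definition word (x : full_shift) (a : int) (l : nat) : seq bool :=
  mkseq (fun j => x (a + j%:Z)) l.

Lemma size_word x a l : size (word x a l) = l.
Proof. exact: size_mkseq. Qed.

Lemma word_eqP x y a b l :
  word x a l = word y b l <->
  forall j : nat, (j < l)%N -> x (a + j%:Z) = y (b + j%:Z).
Proof.
split=> [xy j jl|xy].
  by have := congr1 (nth false ^~ j) xy; rewrite !nth_mkseq.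
apply: (@eq_from_nth _ false); rewrite !size_word // => j jl.
by rewrite !nth_mkseq // xy.
Qed.

Lemma word_cat x a m n :
  word x a (m + n) = word x a m ++ word x (a + m%:Z) n.
Proof.
rewrite /word /mkseq iotaD map_cat add0n -{2}[m]addn0 iotaDl -map_comp.
by congr (_ ++ _); apply: eq_map => j /=; rewrite PoszD addrA.
Qed.

Lemma word1 x a : word x a 1 = [:: x a].
Proof. by rewrite -[a in RHS]addr0. Qed.

Lemma word_shiftz k x a l : word (shiftz k x) a l = word x (a + k) l.
Proof. by apply/word_eqP => j _; rewrite /shiftz addrAC. Qed.

Lemma language_word Y y i l : Y y -> language Y (word y i l).
Proof. by move=> Yy; exists y => //; exists i, l. Qed.

(** * Closure and minimality in terms of words *)

Lemma nbhs_word (x : full_shift) a l :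
  nbhs x [set y | word y a l = word x a l].
Proof.
elim: l => [|l IHl]; first exact: filterS filterT.
have xl : nbhs x [set y : full_shift | y (a + l%:Z) = x (a + l%:Z)].
  exact: (@proj_continuous int (fun=> bool) (a + l%:Z) x [set x (a + l%:Z)]).
apply: filterS (filterI IHl xl) => y [/= yl yxl].
by rewrite /= -addn1 !word_cat !word1 yl yxl.
Qed.

(** Cylinders form a neighborhood basis: points that agree with x on larger and
larger windows around 0 converge to x. *)
Lemma closure_wordP (A : set full_shift) (x : full_shift) :
  closure A x <-> forall a l, exists2 y, A y & word y a l = word x a l.
Proof.
split=> [clAx a l|Ax].
  by have [y [Ay xy]] := clAx _ (nbhs_word x a l); exists y.
have /choice[f f_x] : forall N : nat, exists y,
    A y /\ word y (- N%:Z) (N + N).+1 = word x (- N%:Z) (N + N).+1.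
  by move=> N; have [y Ay yx] := Ax (- N%:Z) (N + N).+1; exists y.
have f_cvg : f @ \oo --> x.
  have eval_surj i : @^~ i @` [set: full_shift] = [set: bool].
    by apply/seteqP; split=> // b _; exists (fun=> b).
  apply/cvg_sup => i; apply/cvg_image; first exact: eval_surj.
  move=> B /nbhs_singleton Bxi.
  exists (@^~ i @^-1` B); last exact/image_preimage/eval_surj.
  exists `|i|%N => // N /= iN.
  have [_ /word_eqP/(_ (absz (i + N%:Z)))] := f_x N.
  have -> : - N%:Z + (absz (i + N%:Z))%:Z = i by lia.
  by move=> ->; [exact: Bxi | lia].
move=> B /f_cvg[N _ NB]; exists (f N); split; first by have [] := f_x N.
exact/NB/leqnn.
Qed.

Lemma subshift_shiftz Y k x : subshift Y -> Y x -> Y (shiftz k x).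
Proof.
move=> [_ shY].
have nat_shift n z : Y z -> Y (shiftz n%:Z z).
  rewrite -iter_shift => Yz; elim: n => //= n IHn.
  by rewrite -shY; exists (iter n Defs.shift z).
case: k => [n|n]; first exact: nat_shift.
rewrite NegzE; elim: n.+1 x => [|m IHm] z Yz.
  by rewrite oppr0; exact: (nat_shift 0%N).
have [t Yt tz] : (Defs.shift @` Y) z by rewrite shY.
suff -> : shiftz (- m.+1%:Z) z = shiftz (- m%:Z) t by exact: IHm.
by rewrite -tz; apply/funext => i; rewrite /shiftz /Defs.shift; congr t; lia.
Qed.

Lemma minimal_wordP Y :
  minimal_subshift Y <->
  [/\ subshift Y, Y !=set0 &
      forall y z a l, Y y -> Y z -> exists b, word y b l = word z a l].
Proof.
split=> -[Ysub Y0 Ymin]; split=> //.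
  move=> y z a l Yy Yz.
  have [_ [k _ <-]] := (closure_wordP _ _).1 (Ymin y Yy z Yz) a l.
  by rewrite word_shiftz; exists (a + k).
move=> y Yy z Yz; apply/closure_wordP => a l.
have [b bz] := Ymin y z a l Yy Yz.
exists (shiftz (b - a) y); first by exists (b - a).
by rewrite word_shiftz addrC subrK.
Qed.

Lemma language_occurs Y y u : minimal_subshift Y -> Y y -> language Y u ->
  exists i, u = word y i (size u).
Proof.
move=> /minimal_wordP[_ _ Ymin] Yy [z Yz [i [l uE]]].
by have [b yb] := Ymin y z i l Yy Yz; exists b; rewrite uE size_word yb.
Qed.

(** Otherwise there are points of Y avoiding the word on larger and larger
windows around 0; a cluster point of these avoids it everywhere, against
minimality. *)
Lemma bounded_gaps Y z a l : minimal_subshift Y -> Y z ->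
  exists M, forall y i, Y y ->
    exists2 p, (p <= M)%N & word y (i + p%:Z) l = word z a l.
Proof.
move=> /minimal_wordP[Ysub Y0 Ymin] Yz; have [Ycl Yinv] := Ysub.
suff [M gapM] : exists M, forall y, Y y ->
    exists2 k : int, (`|k| <= M)%N & word y k l = word z a l.
  exists (M + M)%N => y i Yy.
  have [k kM yk] := gapM _ (subshift_shiftz _ (i + M%:Z) _ Ysub Yy).
  exists (absz (k + M%:Z)); first by lia.
  by rewrite -yk word_shiftz; congr (word y _ l); lia.
apply: contrapT => /forallNP no_gap.
have /choice[f f_avoid] : forall M, exists y, Y y /\
    forall k : int, (`|k| <= M)%N -> word y k l <> word z a l.
  move=> M; have /existsNP[y /not_implyP[Yy avoid]] := no_gap M.
  by exists y; split=> // k kM yk; apply: avoid; exists k.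
have cptY : compact Y.
  rewrite -[Y]setTI; apply: compact_closedI => //.
  have := @tychonoff int (fun=> bool) (fun=> setT) (fun=> bool_compact).
  by congr (compact _); apply/seteqP; split.
have fY : (f @ \oo) Y by exists 0%N => // M _; have [] := f_avoid M.
have [y [Yy fy]] := cptY (f @ \oo) _ fY.
have [b yb] := Ymin y z a l Yy Yz.
have f_tail : (f @ \oo) [set x | exists2 M, (`|b| <= M)%N & x = f M].
  by exists `|b|%N => // M /= bM; exists M.
have [_ [[M bM ->] fMb]] := fy _ _ f_tail (nbhs_word y b l).
by have [_ /(_ b bM)] := f_avoid M; apply; rewrite fMb.
Qed.

(** * The difference map *)

Definition parity (u : seq bool) : bool :=
  odd (\sum_(0 <= j < size u) nth false u j)%N.

Lemma parityE u : parity u = odd (\sum_(b <- u) b)%N.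
Proof. by rewrite /parity (big_nth false). Qed.

Lemma parity_cat u v : parity (u ++ v) = parity u (+) parity v.
Proof. by rewrite !parityE big_cat oddD. Qed.

Lemma eta22E x n : eta22 x n = x (n + 1) (+) x n.
Proof. by []. Qed.

Lemma eta22_shiftz k x : eta22 (shiftz k x) = shiftz k (eta22 x).
Proof. by apply/funext => n; rewrite !eta22E /shiftz eta22E addrAC. Qed.

Lemma eta22_neg (x : full_shift) : eta22 (fun n => ~~ x n) = eta22 x.
Proof. by apply/funext => n; rewrite !eta22E addNb addbN negbK. Qed.

(** The preimage vanishing at 0 is obtained by summing y away from 0 on either
side; signs do not matter modulo 2. *)
Lemma eta22_surj y : exists x, eta22 x = y.
Proof.
exists (fun n => match n with
  | Posz k => \sum_(i < k) y i%:Z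
  | Negz k => \sum_(i < k.+1) y (Negz i) end).
apply/funext => -[k|[|k]]; rewrite eta22E.
- by rewrite -PoszD addn1 big_ord_recr /=; case: (y k); case: (\sum_(_ < _) _).
- by rewrite /= big_ord0 big_ord_recr big_ord0; case: (y _).
- have -> : Negz k.+1 + 1 = Negz k by lia.
  rewrite [in X in _ (+) X]big_ord_recr /=.
  by case: (y _); case: (\sum_(_ < _) _).
Qed.

(** The sum telescopes. *)
Lemma parity_eta22 x a n : parity (word (eta22 x) a n) = x (a + n%:Z) (+) x a.
Proof.
elim: n => [|n IHn]; first by rewrite addr0 addbb parityE big_nil.
rewrite -addn1 word_cat parity_cat IHn word1 parityE big_seq1 eta22E oddb.
by rewrite PoszD addrA; case: (x a); case: (x (a + n)); case: (x _).
Qed.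

Lemma word_eta22 x y a b l :
  word x a l.+1 = word y b l.+1 -> word (eta22 x) a l = word (eta22 y) b l.
Proof.
move=> /word_eqP xy; apply/word_eqP => j jl.
by rewrite !eta22E -!addrA -PoszD !xy //; lia.
Qed.

Lemma eta22_word_diff x y a b l j : (j <= l)%N ->
  word (eta22 x) a l = word (eta22 y) b l ->
  x (a + j%:Z) (+) x a = y (b + j%:Z) (+) y b.
Proof.
move=> jl /(congr1 (parity \o take j)) /=.
by rewrite -(subnKC jl) !word_cat !take_size_cat ?size_word // !parity_eta22.
Qed.

Lemma word_of_eta22 x y a b l : x a = y b ->
  word (eta22 x) a l = word (eta22 y) b l -> word x a l.+1 = word y b l.+1.
Proof.
move=> xyab xy; apply/word_eqP => j; rewrite ltnS => jl.
have := eta22_word_diff _ _ _ _ _ j jl xy; rewrite xyab.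
exact: addIb.
Qed.

(** This translates the words w v w of the theorem, with w v of length q and w
of length n, into complemented repetitions in a preimage. *)
Lemma flipP x a q n :
  (parity (word (eta22 x) a q) /\
   word (eta22 x) (a + q%:Z) n = word (eta22 x) a n) <->
  forall j : nat, (j <= n)%N -> x (a + q%:Z + j%:Z) = ~~ x (a + j%:Z).
Proof.
split=> [[odd_q eq_n] j jn|flip].
  move: odd_q; rewrite parity_eta22.
  have := eta22_word_diff _ _ _ _ _ _ jn eq_n.
  by do 4 case: (x _).
split; first by rewrite parity_eta22 -[a + q]addr0 flip // addr0; case: (x a).
apply/word_eqP => j jn; rewrite !eta22E -addrA -[in RHS]addrA -!PoszD addn1.
by rewrite !flip //; [case: (x _); case: (x _) | exact: ltnW].
Qed.

Lemma preimage_subshift Y : subshift Y -> subshift (eta22 @^-1` Y).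
Proof.
move=> Ysub; have [Ycl _] := Ysub; split.
  move=> x clx; apply: Ycl; apply/closure_wordP => a l.
  have [x' Yx' xx'] := (closure_wordP _ _).1 clx a l.+1.
  by exists (eta22 x') => //; exact: word_eta22.
have shiftX k x : (eta22 @^-1` Y) x -> (eta22 @^-1` Y) (shiftz k x).
  by rewrite /= eta22_shiftz => Yx; exact: subshift_shiftz.
apply/seteqP; split=> [_ [x Yx <-]|x Yx]; first exact: (shiftX 1).
exists (shiftz (-1) x); first exact: shiftX.
exact: (shiftzNK 1).
Qed.

(** * Complemented repetitions in a minimal subshift *)

(** Translating by k an odd number of times complements an odd number of
times. *)
Lemma flip_odd_multiple (x : full_shift) a k N m :
  (forall j : nat, (j <= N)%N -> x (a + k%:Z + j%:Z) = ~~ x (a + j%:Z)) ->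
  forall j : nat, (j + m * 2 * k <= N)%N ->
    x (a + ((m * 2).+1 * k)%:Z + j%:Z) = ~~ x (a + j%:Z).
Proof.
move=> flip; elim: m => [|m IHm] j jN; first by rewrite mul1n flip //; lia.
have -> : a + ((m.+1 * 2).+1 * k)%:Z + j%:Z =
  a + k%:Z + (j + (m.+1 * 2) * k)%:Z by lia.
rewrite flip //.
have -> : a + (j + m.+1 * 2 * k)%:Z = a + k%:Z + (j + (m * 2).+1 * k)%:Z by lia.
rewrite flip; last by lia.
have -> : a + (j + (m * 2).+1 * k)%:Z = a + ((m * 2).+1 * k)%:Z + j%:Z by lia.
by rewrite IHm ?negbK //; lia.
Qed.

(** A word of the complement of x occurs in x by minimality, but possibly at a
distance k < n; an odd multiple of k then takes over, which requires a word
long enough to iterate the translation. *)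
Lemma far_flip X x n : minimal_subshift X -> X x -> X (fun i => ~~ x i) ->
  exists a q, (n <= q)%N /\
    forall j : nat, (j <= n)%N -> x (a + q%:Z + j%:Z) = ~~ x (a + j%:Z).
Proof.
move=> /minimal_wordP[_ _ Xmin] Xx Xnx.
(* For k < n, the multiple (2n + 1) k exceeds n and the length N needed by
   flip_odd_multiple is at most n + 2n * n. *)
pose N := (n + n * 2 * n)%N.
have [b /word_eqP xb] := Xmin x _ 0 N.+1 Xx Xnx.
have [a [k [k_gt0 flip]]] : exists a k, (0 < k)%N /\
    forall j : nat, (j <= N)%N -> x (a + k%:Z + j%:Z) = ~~ x (a + j%:Z).
  (* The occurrence may lie to the left of 0; complementation being involutive,
     the two places then exchange roles. *)
  case: b xb => [[|k]|k] xb.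
  - by have := xb 0%N isT; case: (x _).
  - by exists 0, k.+1; split=> // j jN; rewrite add0r xb.
  - exists (Negz k), k.+1; split=> // j jN.
    have -> : Negz k + k.+1%:Z = 0 by lia.
    by rewrite xb // negbK.
have [nk|kn] := leqP n k.
  by exists a, k; split=> // j jn; apply: flip; rewrite /N; lia.
exists a, ((n * 2).+1 * k)%N; split; first by nia.
by move=> j jn; apply: (flip_odd_multiple x a k N) => //; rewrite /N; nia.
Qed.

(** * The criterion *)

Theorem corollary1p8 (Y : set full_shift) (hY : minimal_subshift Y) :
  minimal_subshift (eta22 @^-1` Y) <->
  exists w v : nat -> seq bool,
    [/\ forall n, language Y (w n) /\ language Y (v n),
        size (w n) @[n --> \oo] --> \oo &
        forall n,
          language Y (w n ++ v n ++ w n) /\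
          odd (\sum_(0 <= j < size (w n ++ v n)) nth false (w n ++ v n) j)%N].
Proof.
have [Ysub [y0 Yy0] _] := hY.
have [x0 x0y0] := eta22_surj y0.
have Xx0 : (eta22 @^-1` Y) x0 by rewrite /= x0y0.
split=> [minX|[w [v [_ w_oo wvw]]]].
  have Xnx0 : (eta22 @^-1` Y) (fun i => ~~ x0 i) by rewrite /= eta22_neg.
  have /choice[f f_flip] : forall n : nat, exists aq : int * nat,
      (n <= aq.2)%N /\ forall j : nat, (j <= n)%N ->
        x0 (aq.1 + aq.2%:Z + j%:Z) = ~~ x0 (aq.1 + j%:Z).
    move=> n; have [a [q aq]] := far_flip _ _ n minX Xx0 Xnx0.
    by exists (a, q).
  exists (fun n => word y0 (f n).1 n).
  exists (fun n => word y0 ((f n).1 + n%:Z) ((f n).2 - n)).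
  split=> [n||n]; first by split; exact: language_word.
    by under eq_fun do rewrite size_word; exact: cvg_id.
  case: (f n) (f_flip n) => a q /= [nq /flipP[odd_q eq_n]].
  rewrite x0y0 in odd_q eq_n.
  have wv : word y0 a n ++ word y0 (a + n%:Z) (q - n) = word y0 a q.
    by rewrite -word_cat subnKC.
  split; last by rewrite -/(parity _) wv.
  by rewrite catA wv -eq_n -word_cat; exact: language_word.
apply/minimal_wordP; split; [exact: preimage_subshift | by exists x0 |].
move=> x z a [|l] Xx Xz; first by exists 0.
have [M gapM] := bounded_gaps Y (eta22 z) a l hY Xz.
have [n Mln] : exists n, (M + l <= size (w n))%N.
  have [n _ /(_ n (leqnn n)) /= Mln] := w_oo _ (nbhs_infty_ge (M + l)).
  by exists n.
have [lang_wvw odd_wv] := wvw n.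
have [i wvwE] := language_occurs Y (eta22 x) _ hY Xx lang_wvw.
pose q := size (w n ++ v n).
have [wvE wE] : w n ++ v n = word (eta22 x) i q /\
    w n = word (eta22 x) (i + q%:Z) (size (w n)).
  move: wvwE; rewrite catA size_cat word_cat => /eqP.
  by rewrite eqseq_cat ?size_word // => /andP[/eqP ? /eqP].
have w_i : w n = word (eta22 x) i (size (w n)).
  have := congr1 (take (size (w n))) wvE.
  by rewrite /q size_cat word_cat !take_size_cat ?size_word.
have flip : forall j : nat, (j <= size (w n))%N ->
    x (i + q%:Z + j%:Z) = ~~ x (i + j%:Z).
  by apply/flipP; rewrite -wE -w_i -wvE.
have [p pM xp] := gapM (eta22 x) i Xx.
(* At i + p, the sequence x reads the word of z or its complement; in the latter
   case, it reads the word of z at i + q + p. *)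
have [xza|xza] := eqVneq (x (i + p%:Z)) (z a).
  by exists (i + p%:Z); exact: word_of_eta22.
exists (i + q%:Z + p%:Z); apply/word_eqP => j jl.
rewrite -addrA -PoszD flip; last by lia.
rewrite PoszD addrA; apply: negb_inj; rewrite negbK.
have /word_eqP -> // : word x (i + p%:Z) l.+1 = word (fun k => ~~ z k) a l.+1.
apply: word_of_eta22; last by rewrite eta22_neg.
by move: xza; case: (x _); case: (z a).
Qed.
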